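(* Let $\alpha\in\partial\mathcal{D}$. For an arbitrary $z\in\overline{\mathcal{D}}\setminus\{-\alpha,\alpha\}$, the orbit $\{U_n(z)\}_{n\in\mathbb{N}}$ lies entirely on the circle $H_z$ through the three points $\alpha$, $-\alpha$ and $z$ (where, if $z$ belongs to the open segment $l_\alpha=\{x\alpha: x\in(-1,1)\}$, the circle $H_z$ is degenerate, namely it is the straight line containing $l_\alpha$).
   Context: $\mathcal{D}$ is the open unit disk in $\mathbb{C}$ centered at $0$, $\overline{\mathcal{D}}$ its closure, $\partial\mathcal{D}$ the unit circle. Fix $\alpha\in\partial\mathcal{D}$. For $x\in(-1,1)$ let $q_{x,\alpha}(z)=\frac{z+x\alpha}{1+x\bar\alpha z}$ for $z\in\overline{\mathcal{D}}$. For $\gamma\in\mathbb{R}$ let $g_\gamma:=q_{x,\alpha}$ where $x\in(-1,1)$ is determined by $\gamma=\log\frac{1+x}{1-x}$. Let $(x_n)_{n\in\mathbb{N}}$ be a stationary and ergodic sequence of random variables with values in $(-1,1)$; put $\gamma_n=\log\frac{1+x_n}{1-x_n}$, $\omega_0=0$, $\omega_n=\sum_{i=1}^n\gamma_i$, and $U_n:=g_{\omega_n}$ for $n\in\mathbb{Z}_+=\mathbb{N}\cup\{0\}$. The claim holds for every realization of the sequence. *)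

(* Defs.v *)
From HB Require Import structures.
From mathcomp Require Import all_boot all_order all_algebra.
From mathcomp Require Import all_classical all_reals all_analysis.
From mathcomp Require Import ring lra complex.
Import Order.TTheory GRing.Theory Num.Theory.
Import numFieldNormedType.Exports.

Set Implicit Arguments.
Unset Strict Implicit.
Unset Printing Implicit Defensive.

Local Open Scope classical_set_scope.
Local Open Scope ring_scope.
Local Open Scope complex_scope.

Definition disk (R : realType) : set R[i] := [set z | `|z| < 1].

(* The topology on R[i] is the one given by its R[i]-valued norm; it is found
   through the numFieldType structure, hence the cast. *)
Definition cdisk (R : realType) : set R[i] :=
  closure (@disk R : set (R[i] : numFieldType)).

(* For |x| < 1 and |z| <= 1 = |alpha| the denominator does not vanish. *)
Definition q (R : realType) (x : R) (alpha z : R[i]) : R[i] :=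
  (z + x%:C * alpha) / (1 + x%:C * alpha^* * z).

Definition log_ratio (R : realType) (x : R) : R := ln ((1 + x) / (1 - x)).

Lemma log_ratio_bij (R : realType) (gamma : R) :
  exists! x : R, -1 < x < 1 /\ gamma = log_ratio x.
Proof.
have e0 := expR_gt0 gamma.
have e1 : expR gamma + 1 != 0 by rewrite gt_eqF// addr_gt0.
exists ((expR gamma - 1) / (expR gamma + 1)); split.
  split.
    by rewrite ltr_pdivlMr ?addr_gt0// ltr_pdivrMr ?addr_gt0//; lra.
  rewrite /log_ratio -[LHS]expRK; congr ln.
  by field; rewrite e1 /= gt_eqF//; lra.
move=> x [/andP[x1 x2] ->]; rewrite /log_ratio lnK.
  have h : 1 - x != 0 by rewrite gt_eqF// subr_gt0.
  by field; rewrite h /= gt_eqF//; lra.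
by rewrite posrE divr_gt0//; lra.
Qed.

(* xget picks the x in (-1, 1) with gamma = log_ratio x, which exists and is
   unique by log_ratio_bij; the default value 0 is never used. *)
Definition g (R : realType) (alpha : R[i]) (gamma : R) : R[i] -> R[i] :=
  q (xget 0 [set x : R | -1 < x < 1 /\ gamma = log_ratio x]) alpha.

(* A sequence x_1, x_2, ... is encoded as u : nat -> R with u i = x_{i+1}. *)
Definition omega (R : realType) (u : nat -> R) (n : nat) : R :=
  \sum_(i < n) log_ratio (u i).

Definition U (R : realType) (alpha : R[i]) (u : nat -> R) (n : nat) :
  R[i] -> R[i] := g alpha (omega u n).

(* The product sigma-algebra on R^nat, generated by the coordinates. *)
Definition seq_measurable (R : realType) : set (set (nat -> R)) :=
  <<s [set C | exists i (A : set R), measurable A /\ C = [set u | A (u i)]] >>.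

Definition shift (R : realType) (u : nat -> R) : nat -> R := fun i => u i.+1.

Definition realization (T : Type) (R : realType) (X : nat -> T -> R) (w : T) :
  nat -> R := fun i => X i w.

Definition stationary d (T : measurableType d) (R : realType)
    (P : probability T R) (X : nat -> T -> R) : Prop :=
  forall B : set (nat -> R), seq_measurable B ->
    P (realization X @^-1` (@shift R @^-1` B)) = P (realization X @^-1` B).

Definition ergodic d (T : measurableType d) (R : realType)
    (P : probability T R) (X : nat -> T -> R) : Prop :=
  forall B : set (nat -> R), seq_measurable B -> @shift R @^-1` B = B ->
    P (realization X @^-1` B) = 0%E \/ P (realization X @^-1` B) = 1%E.

Definition is_circle (R : realType) (S : set R[i]) : Prop :=
  exists (c : R[i]) (r : R), 0 < r /\ S = [set w | `|w - c| = r%:C].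

Definition is_line (R : realType) (S : set R[i]) : Prop :=
  exists a v : R[i], v != 0 /\ S = range (fun t : R => a + t%:C * v).

Definition open_segment (R : realType) (alpha : R[i]) : set R[i] :=
  [set x%:C * alpha | x in [set x : R | -1 < x < 1]].

(* The (possibly degenerate) circle through alpha, -alpha and z, as a property
   of the set H: three collinear points are on no circle of positive radius. *)
Definition is_H (R : realType) (alpha z : R[i]) (H : set R[i]) : Prop :=
  (open_segment alpha z -> is_line H /\ open_segment alpha `<=` H) /\
  (~ open_segment alpha z ->
     is_circle H /\ [/\ H alpha, H (- alpha) & H z]).

(* Main.v *)
(** Dividing by [alpha] reduces to [alpha = 1].  For [w] off the real axis, the
   circle through [1], [-1] and [w] is [|v|^2 - 1 = 2 s Im v], centered at [i s].
   The Moebius map [w |-> (w + y) / (1 + y w)] multiplies both [|w|^2 - 1] and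
   [Im w] by [(1 - y^2) / |1 + y w|^2], so it preserves their ratio [2 s]. *)
Require Import Defs.
From HB Require Import structures.
From mathcomp Require Import all_boot all_order all_algebra.
From mathcomp Require Import all_classical all_reals all_analysis.
From mathcomp Require Import complex.
From mathcomp Require Import ring lra.
Import Order.TTheory GRing.Theory Num.Theory.
Import numFieldNormedType.Exports.
Local Open Scope classical_set_scope.
Local Open Scope ring_scope.
Local Open Scope complex_scope.

Lemma cdisk_norm_le1 (R : realType) (z : R[i]) : cdisk (R:=R) z -> `|z| <= 1.
Proof.
move=> hz; rewrite real_leNgt ?realE ?normr_ge0 ?ler01//.
apply/negP => z1.
have e0 : 0 < `|z| - 1 by rewrite subr_gt0.
have [y [/= y1]] := hz _ (@nbhsx_ballx _ (R[i] : numFieldType) z _ e0).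
rewrite -ball_normE /= ltrBrDr => zy.
have zy1 : `|z - y| + `|y| < `|z - y| + 1 by rewrite ltrD2l.
by have := le_lt_trans (ler_normD (z - y) y) (lt_trans zy1 zy); rewrite subrK ltxx.
Qed.

(** Squaring turns norm equations in [R[i]] into real polynomial ones, which [lra] and [field] can
    treat. *)
Lemma norm_eq_sqr (R : realType) (z : R[i]) (r : R) : 0 <= r ->
  (`|z| = r%:C) <-> (complex.Re z ^+ 2 + complex.Im z ^+ 2 = r ^+ 2).
Proof.
move=> r0; rewrite normc_def; split=> [[<-]|->].
  by rewrite sqr_sqrtr// addr_ge0// sqr_ge0.
by rewrite sqrtr_sqr ger0_norm.
Qed.

(** This is the reduction to [alpha = 1]: the conjugate in the denominator cancels the factor
    [alpha], since [|alpha| = 1]. *)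
Lemma q_rotate (R : realType) (x : R) (alpha w : R[i]) : `|alpha| = 1 ->
  q x alpha (alpha * w) = alpha * q x 1 w.
Proof.
move=> a1; have aa : (alpha * Num.conj alpha) = 1 by rewrite -normCK a1 expr1n.
rewrite /q rmorph1 !mulr1 -!mulrA [Num.conj _ * _]mulrA.
by rewrite [Num.conj _ * _]mulrC aa mul1r mulrA mulrDr [alpha * x%:C]mulrC.
Qed.

Lemma q1_real (R : realType) (x y : R) : q y 1 x%:C = ((x + y) / (1 + y * x))%:C.
Proof. by rewrite /q rmorph1 !mulr1 fmorph_div !rmorphD rmorphM rmorph1. Qed.

(** Multiply numerator and denominator by the conjugate of the latter; [N] is the squared norm of
    the denominator. If [N] vanished, [b != 0] would force [y = 0], and then [N = 1]. *)
Lemma q1E (R : realType) (y a b : R) : b != 0 ->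
  let N := (1 + y * a) ^+ 2 + (y * b) ^+ 2 in
  N != 0 /\ q y 1 (a +i* b) =
    (((a + y) * (1 + y * a) + y * b ^+ 2) / N) +i* (b * (1 - y ^+ 2) / N).
Proof.
move=> b0 N.
have N0 : N != 0.
  rewrite paddr_eq0 ?sqr_ge0// !sqrf_eq0 mulf_eq0 (negPf b0) orbF.
  by apply/andP => -[/[swap]/eqP->]; rewrite mul0r addr0 oner_eq0.
split=> //; rewrite /q rmorph1 !mulr1.
have D0 : 1 + y%:C * (a +i* b) != 0 :> R[i].
  apply: contra_neq N0 => /eqP; rewrite eq_complex /= => /andP[/eqP h1 /eqP h2].
  by move: h1 h2; rewrite !mul0r subr0 addr0 add0r /N => -> ->; rewrite !expr0n addr0.
apply: (mulIf D0); rewrite divfK//; apply/eqP; rewrite eq_complex /=.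
by apply/andP; split; apply/eqP; rewrite /N; field; exact: N0.
Qed.

Lemma q1_circle (R : realType) (y s : R) (w : R[i]) : complex.Im w != 0 ->
  `|w - 0 +i* s| = (Num.sqrt (1 + s ^+ 2))%:C ->
  `|q y 1 w - 0 +i* s| = (Num.sqrt (1 + s ^+ 2))%:C.
Proof.
case: w => a b /= b0; have [N0 ->] := q1E R y a b b0.
have s1 : 0 <= 1 + s ^+ 2 by rewrite addr_ge0// sqr_ge0.
rewrite !norm_eq_sqr ?sqrtr_ge0// sqr_sqrtr//= !subr0 => h.
(* In the equation [h] the squares of [s] cancel, so it is linear in [s]. Once [s] is replaced, the
   goal is an identity of rational functions in [a], [b], [y]. *)
have -> : s = (a ^+ 2 + b ^+ 2 - 1) / (b *+ 2).
  apply: (canRL (mulfK _)); last by lra.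
  by rewrite mulrn_eq0.
by field; rewrite b0.
Qed.

(** Equal distance to [1] and [-1] puts the center on the imaginary axis; comparing with the
    distance to [w] fixes its height. Read from right to left this gives existence of the circle,
    from left to right uniqueness. *)
Lemma circle_center (R : realType) (w c : R[i]) (r : R) :
  0 < r -> complex.Im w != 0 ->
  let s := (complex.Re w ^+ 2 + complex.Im w ^+ 2 - 1) / (complex.Im w *+ 2) in
  [/\ `|1 - c| = r%:C, `|-1 - c| = r%:C & `|w - c| = r%:C] <->
  c = 0 +i* s /\ r = Num.sqrt (1 + s ^+ 2).
Proof.
case: w c => [a b] [c d] r0 /= b0; set s := _ / _.
have b20 : b *+ 2 != 0 by rewrite mulrn_eq0.
have s1 : 0 <= 1 + s ^+ 2 by rewrite addr_ge0// sqr_ge0.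
have hs : s * (b *+ 2) = a ^+ 2 + b ^+ 2 - 1 by rewrite divfK.
have nE v := norm_eq_sqr R v r (ltW r0); split.
  move=> [/nE/= h1 /nE/= h2 /nE/= h3]; have c0 : c = 0 by lra.
  have ds : d = s.
    by apply: (mulIf b20); rewrite hs; move: h1 h3; rewrite c0; lra.
  split; first by rewrite c0 ds.
  by rewrite -[LHS](gtr0_norm r0) -sqrtr_sqr -h1 c0 ds; congr Num.sqrt; ring.
move=> [[-> ->] rE].
have r2 : r ^+ 2 = 1 + s ^+ 2 by rewrite rE sqr_sqrtr.
by split; apply/nE => /=; rewrite r2; lra.
Qed.

Lemma open_segment_rotate (R : realType) (alpha w : R[i]) : alpha != 0 ->
  open_segment alpha (alpha * w) <-> open_segment 1 w.
Proof.
move=> a0; split=> -[x hx].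
  by move=> /eqP; rewrite mulrC (inj_eq (mulfI a0)) => /eqP <-; exists x; rewrite ?mulr1.
by rewrite mulr1 => <-; exists x => //; rewrite mulrC.
Qed.

(** The closed disk meets the real axis in [[-1, 1]], whose endpoints are excluded. So the
    degenerate case can be recognized by [Im w = 0]. *)
Lemma open_segment1P (R : realType) (w : R[i]) :
  `|w| <= 1 -> w != 1 -> w != -1 -> open_segment 1 w <-> complex.Im w = 0.
Proof.
case: w => a b; rewrite normc_def lecR /= => w1 n1 n2; split.
  by move=> [x _]; rewrite mulr1 => -[_ <-].
move=> b0; move: w1 n1 n2; rewrite b0 expr0n addr0 sqrtr_sqr ler_norml.
rewrite !eq_complex /= oppr0 eqxx !andbT => /andP[a1 a2] n1 n2.
by exists a; rewrite ?mulr1//= !lt_neqAle a1 a2 n1 eq_sym n2.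
Qed.

Lemma is_line_open_segment (R : realType) (alpha : R[i]) (L : set R[i]) :
  alpha != 0 -> is_line L -> open_segment alpha `<=` L ->
  L = range (fun t : R => t%:C * alpha).
Proof.
move=> a0 [p [v [v0 ->]]] hL.
(* Two points of the open segment determine the line; [0] and [alpha / 2] are used, as [alpha]
   itself is not in the segment. *)
have [t0 _ h0] : range (fun t : R => p + t%:C * v) 0.
  by apply: hL; exists 0; rewrite ?mul0r//= ltrN10 ltr01.
have [t1 _ h1] : range (fun t : R => p + t%:C * v) (2^-1%:C * alpha).
  by apply: hL; exists 2^-1 => //=; apply/andP; split; lra.
have hp : p = - (t0%:C * v) by apply/eqP; rewrite -addr_eq0 h0.
have ha : alpha = (2 * (t1 - t0))%:C * v.
  have -> : alpha = 2%:C * (2^-1%:C * alpha).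
    by rewrite mulrA -rmorphM mulfV ?mul1r// pnatr_eq0.
  by rewrite -h1 hp rmorphM rmorphB/= -mulrA mulrBl addrC.
have k0 : 2 * (t1 - t0) != 0.
  by apply: contra_neq a0 => k0; rewrite ha k0 mul0r.
(* With [k = 2 * (t1 - t0)], the points are [p + t v = ((t - t0) / k) alpha], so the two
   parametrizations differ by an invertible affine change. *)
apply/seteqP; split=> _ [t _ <-] /=.
  exists ((t - t0) / (2 * (t1 - t0))) => //.
  by rewrite ha mulrA -rmorphM divfK// hp rmorphB/= mulrBl addrC.
exists (t0 + t * (2 * (t1 - t0))) => //.
by rewrite hp ha [RHS]mulrA -rmorphM rmorphD mulrDl addKr.
Qed.

Theorem lemma1 (R : realType) (d : measure_display) (T : measurableType d)
    (P : probability T R) (alpha : R[i]) (halpha : `|alpha| = 1)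
    (X : nat -> {RV P >-> R})
    (hX : forall (n : nat) (w : T), -1 < X n w < 1)
    (hstat : stationary P X) (herg : ergodic P X)
    (z : R[i]) (hz : (@cdisk R `\` [set - alpha; alpha]) z) :
  exists H : set R[i],
    unique (is_H alpha z) H /\
    forall (w : T) (n : nat), (0 < n)%N -> H (U alpha (realization X w) n z).
Proof.
have a0 : alpha != 0 by rewrite -normr_eq0 halpha oner_eq0.
have nalpha v : `|alpha * v| = `|v| by rewrite normrM halpha mul1r.
case: hz => /cdisk_norm_le1 z1 zNa.
have [w zE] : exists w, z = alpha * w by exists (alpha^-1 * z); rewrite mulVKf.
have w1 : w != 1.
  by apply/eqP => h; apply: zNa; right; rewrite zE h mulr1.
have wN1 : w != -1.
  by apply/eqP => h; apply: zNa; left; rewrite zE h mulrN1.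
have wle1 : `|w| <= 1 by rewrite -nalpha -zE.
have segP := open_segment1P R w wle1 w1 wN1.
have segE := open_segment_rotate R alpha w a0.
rewrite /is_H /U /g zE.
(* Each [U] is now [q y alpha] with [y] real. Either [w] is real and the line through [0] and
   [alpha] is kept, or the circle is. *)
have [b0|b0] := eqVneq (complex.Im w) 0.
  have seg : open_segment alpha (alpha * w) by apply/segE/segP.
  exists (range (fun t : R => t%:C * alpha)); split.
    split.
      split=> // _; split; last by move=> _ [x _ <-]; exists x.
      by exists 0, alpha; split=> //; under [in RHS]eq_fun do rewrite add0r.
    by move=> L [/(_ seg)[lL sL] _]; rewrite (is_line_open_segment R alpha L).
  move=> t n _; rewrite q_rotate//.
  have -> : w = (complex.Re w)%:C by case: (w) b0 => a b /= ->.
  by rewrite q1_real mulrC; eexists.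
have seg : ~ open_segment alpha (alpha * w).
  by move=> /segE/segP/eqP; apply/negP.
pose s := (complex.Re w ^+ 2 + complex.Im w ^+ 2 - 1) / (complex.Im w *+ 2).
pose r := Num.sqrt (1 + s ^+ 2).
have r0 : 0 < r by rewrite sqrtr_gt0 ltr_wpDr// sqr_ge0.
have [h1 h2 h3] := (circle_center R w (0 +i* s) r r0 b0).2 (conj erefl erefl).
(* The circle through [1], [-1] and [w], rotated by [alpha]. *)
exists [set v | `|v - alpha * (0 +i* s)| = r%:C]; split.
  split.
    split=> // _; split; first by exists (alpha * (0 +i* s)), r.
    split=> /=; rewrite -?mulrBr ?nalpha//.
      by rewrite -[X in `|X - _|]mulr1 -mulrBr nalpha.
    by rewrite -[X in `|X - _|]mulrN1 -mulrBr nalpha.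
  move=> C [_ /(_ seg)[[c [r' [r'0 ->]]]]] /=.
  (* Rotating a competing circle back by [alpha^-1] lets [circle_center] determine its center and
     radius. *)
  have -> : c = alpha * (alpha^-1 * c) by rewrite mulVKf.
  rewrite -{1}[alpha]mulr1 -(mulrN1 alpha) -!mulrBr !nalpha => h.
  by have [-> ->] := (circle_center R w _ r' r'0 b0).1 h.
move=> t n _ /=; rewrite q_rotate// -mulrBr nalpha.
exact: q1_circle.
Qed.
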